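(* Let $A$ be a real constant $n\times n$ matrix and $B=A^{T}$. Let $\nu^{1}=\overset{*}{\nu}{}^{1}+\widetilde\nu{}^{1} i$ and $\nu^{2}=\overset{*}{\nu}{}^{2}+\widetilde\nu{}^{2} i$ (with $\overset{*}{\nu}{}^{\tau}=\mathrm{Re}\,\nu^{\tau}$, $\widetilde\nu{}^{\tau}=\mathrm{Im}\,\nu^{\tau}$, $\tau=1,2$) be two linearly independent eigenvectors of $B$ corresponding to the non-real eigenvalues $\lambda_1=\overset{*}{\lambda}_1+\widetilde\lambda_1 i$ and $\lambda_2=\overset{*}{\lambda}_2+\widetilde\lambda_2 i$ (with $\overset{*}{\lambda}_\tau=\mathrm{Re}\,\lambda_\tau$, $\widetilde\lambda_\tau=\mathrm{Im}\,\lambda_\tau$), and let $\lambda_1\neq\overline{\lambda}_2$. Then the system $\dfrac{dx}{dt}=Ax$ has the autonomous first integral $$F\colon x\mapsto \widetilde\lambda_1\arctan\frac{\widetilde\nu{}^{2}x}{\overset{*}{\nu}{}^{2}x}-\widetilde\lambda_2\arctan\frac{\widetilde\nu{}^{1}x}{\overset{*}{\nu}{}^{1}x}\quad\text{for all }x\in\mathscr X,$$ where $\mathscr X$ is any domain contained in $\{x\in\mathbb R^n\colon \overset{*}{\nu}{}^{1}x\neq0,\ \overset{*}{\nu}{}^{2}x\neq0\}$.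
   Context: A domain is an open arcwise connected set. For a vector $\nu=(\nu_1,\dots,\nu_n)$ and $x\in\mathbb R^n$, $\nu x=\sum_{\xi=1}^n\nu_\xi x_\xi$. An eigenvector $\nu$ of $B$ with eigenvalue $\lambda$ satisfies $B\nu=\lambda\nu$, $\nu\neq0$ regarded as a column. An autonomous first integral of $dx/dt=Ax$ on a domain $\mathscr X\subset\mathbb R^n$ is a continuously differentiable function $F\colon\mathscr X\to\mathbb R$ with $\sum_{\xi=1}^n (Ax)_\xi\,\partial_{x_\xi}F(x)=0$ for all $x\in\mathscr X$. *)

(* Defs.v *)
From mathcomp Require Export all_boot all_order all_algebra.
From mathcomp Require Export all_classical all_reals all_analysis.
From mathcomp.real_closed Require Export complex.

Set Implicit Arguments.
Unset Strict Implicit.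
Unset Printing Implicit Defensive.

Import Order.TTheory GRing.Theory Num.Theory.
Import numFieldNormedType.Exports.

Local Open Scope classical_set_scope.
Local Open Scope ring_scope.
Local Open Scope complex_scope.

Definition arcwise_connected (R : realType) (T : topologicalType)
    (X : set T) : Prop :=
  forall x y, X x -> X y ->
    exists gamma : R -> T,
      [/\ {within `[0, 1], continuous gamma},
          gamma 0 = x, gamma 1 = y
        & forall t, 0 <= t <= 1 -> X (gamma t)].

Definition domain (R : realType) (n : nat) (X : set 'cV[R]_n) : Prop :=
  open X /\ arcwise_connected R X.

(* Bilinear, without conjugation; only applied to real vectors below. *)
Definition pairing (R : realType) (n : nat) (v x : 'cV[R]_n) : R :=
  \sum_(i < n) v i 0 * x i 0.

Definition Re_vec (R : realType) (n : nat) (v : 'cV[R[i]]_n) : 'cV[R]_n :=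
  map_mx (@complex.Re R) v.
Definition Im_vec (R : realType) (n : nat) (v : 'cV[R[i]]_n) : 'cV[R]_n :=
  map_mx (@complex.Im R) v.

(* Column convention: the library's [eigenspace] acts on row vectors. *)
Definition eigenvector (R : realType) (n : nat) (B : 'M[R]_n)
    (lambda : R[i]) (nu : 'cV[R[i]]_n) : Prop :=
  nu != 0 /\ map_mx (real_complex R) B *m nu = lambda *: nu.

Definition partial (R : realType) (n : nat) (F : 'cV[R]_n -> R) (i : 'I_n)
    (x : 'cV[R]_n) : R :=
  'D_(delta_mx i 0) F x.

(* [F] is total, but on an open [X] only its values on [X] matter. *)
Definition continuously_differentiable (R : realType) (n : nat)
    (X : set 'cV[R]_n) (F : 'cV[R]_n -> R) : Prop :=
  forall i : 'I_n,
    (forall x, X x -> derivable F x (delta_mx i 0)) /\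
    {within X, continuous (partial F i)}.

Definition autonomous_first_integral (R : realType) (n : nat) (A : 'M[R]_n)
    (X : set 'cV[R]_n) (F : 'cV[R]_n -> R) : Prop :=
  continuously_differentiable X F /\
  forall x, X x -> \sum_(i < n) (A *m x) i 0 * partial F i x = 0.

(* Main.v *)
(* Along the flow of dx/dt = A x the complex number nu x, for an eigenvector nu
   of A^T with eigenvalue lambda, satisfies (nu x)' = lambda (nu x); hence its
   argument, of which atan (Im (nu x) / Re (nu x)) is a local determination,
   grows at the constant rate Im lambda.  Weighting the two arguments by
   Im lambda1 and Im lambda2 crosswise makes the two rates cancel. *)

Require Import Defs.
From mathcomp Require Import ring.

Import Order.TTheory GRing.Theory Num.Theory.
Import numFieldNormedType.Exports.

Local Open Scope classical_set_scope.
Local Open Scope ring_scope.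
Local Open Scope complex_scope.

Lemma pairingDr {R : realType} {n : nat} (v x y : 'cV[R]_n) :
  pairing v (x + y) = pairing v x + pairing v y.
Proof. by rewrite -big_split; apply: eq_bigr => i _; rewrite mxE mulrDr. Qed.

Lemma pairingDl {R : realType} {n : nat} (v w x : 'cV[R]_n) :
  pairing (v + w) x = pairing v x + pairing w x.
Proof. by rewrite -big_split; apply: eq_bigr => i _; rewrite mxE mulrDl. Qed.

Lemma pairingZr {R : realType} {n : nat} (c : R) (v x : 'cV[R]_n) :
  pairing v (c *: x) = c * pairing v x.
Proof. by rewrite mulr_sumr; apply: eq_bigr => i _; rewrite mxE mulrCA. Qed.

Lemma pairingZl {R : realType} {n : nat} (c : R) (v x : 'cV[R]_n) :
  pairing (c *: v) x = c * pairing v x.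
Proof. by rewrite mulr_sumr; apply: eq_bigr => i _; rewrite mxE mulrA. Qed.

Lemma pairing_delta {R : realType} {n : nat} (v : 'cV[R]_n) (i : 'I_n) :
  pairing v (delta_mx i 0) = v i 0.
Proof.
rewrite /pairing (bigD1 i) //= big1 => [|j ji].
  by rewrite !mxE !eqxx mulr1 addr0.
by rewrite !mxE (negbTE ji) mulr0.
Qed.

(** The pairing is the matrix product [u^T *m w], so [A] moves to the other side as its transpose,
    where the eigenvector equations apply. *)
Lemma pairing_mulmx {R : realType} {n : nat} (A : 'M[R]_n) (v x : 'cV[R]_n) :
  pairing v (A *m x) = pairing (A^T *m v) x.
Proof.
have pairingE (u w : 'cV[R]_n) : pairing u w = (u^T *m w) 0 0.
  by rewrite mxE; apply: eq_bigr => i _; rewrite mxE.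
by rewrite !pairingE trmx_mul trmxK mulmxA.
Qed.

Lemma continuous_pairing {R : realType} {n : nat} (v : 'cV[R]_n) :
  continuous (pairing v).
Proof.
move=> x; apply: (@cvg_big R _ +%R 0 xpredT _ _ (nbhs x) _
  (fun i (y : 'cV[R]_n) => v i 0 * y i 0)) => [|i _].
  exact: add_continuous.
by apply: cvgM; [exact: cvg_cst|exact: coord_continuous].
Qed.

(** Entries of [B] are real, so multiplication by [B] commutes with taking real and imaginary parts;
    separating the eigenvector equation this way leaves only real computations. *)
Lemma eigenvector_Re_Im {R : realType} {n : nat} (B : 'M[R]_n)
    (lambda : R[i]) (nu : 'cV[R[i]]_n) : eigenvector B lambda nu ->
  B *m Re_vec nu =
    complex.Re lambda *: Re_vec nu - complex.Im lambda *: Im_vec nu /\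
  B *m Im_vec nu =
    complex.Re lambda *: Im_vec nu + complex.Im lambda *: Re_vec nu.
Proof.
case: lambda => a b [_ /matrixP Bnu]; split; apply/matrixP => i j;
  [have := congr1 (@complex.Re R) (Bnu i j)
  |have := congr1 (@complex.Im R) (Bnu i j)];
  rewrite !mxE raddf_sum /=; case: (nu i j) => u v /= <-;
  apply: eq_bigr => k _; rewrite !mxE; case: (nu k j) => p q /=;
  by rewrite mul0r ?subr0 ?addr0.
Qed.

(** Both derivatives are limits of the same difference quotient. This reduces directional
    derivatives to one-variable calculus. *)
Lemma is_derive_line {R : realType} (V W : normedModType R) (f : V -> W)
    (x v : V) (df : W) :
  is_derive (0 : R) 1 (fun h => f (h *: v + x)) df -> is_derive x v f df.
Proof.
move=> [dfx <-]; apply: DeriveDef; first exact/derivable1P.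
rewrite /derive; set g1 := fun h => h^-1 *: _; set g2 := fun h => h^-1 *: _.
suff -> : g1 = g2 by [].
apply/funext => h; rewrite /g1 /g2 /=.
by rewrite addr0 scale0r add0r [_%:A]mulr1.
Qed.

(* The derivative along v of the polar angle of the point (a x, b x), which
   equals atan (b x / a x) up to a locally constant multiple of pi. *)
Definition angular_derive {R : realType} {n : nat} (a b x v : 'cV[R]_n) : R :=
  (pairing a x * pairing b v - pairing b x * pairing a v) /
  (pairing a x ^+ 2 + pairing b x ^+ 2).

Lemma sum_sqr_neq0 {R : realType} {p : R} (q : R) :
  p != 0 -> p ^+ 2 + q ^+ 2 != 0.
Proof. by move=> p0; rewrite paddr_eq0 ?sqr_ge0// sqrf_eq0 (negbTE p0). Qed.

(** On the line through [x] along [v] both pairings are affine in the parameter, so the chain rule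
    for [atan] of a quotient applies; the factor [pairing a x ^+ 2] then cancels. *)
Lemma is_derive_atan_pairing {R : realType} {n : nat} (a b x v : 'cV[R]_n) :
  pairing a x != 0 ->
  is_derive x v (fun y => atan (pairing b y / pairing a y))
    (angular_derive a b x v).
Proof.
move=> ax0; apply: (@is_derive_line R _ _).
have affine (w : 'cV[R]_n) :
    is_derive (0 : R) 1 (fun h => pairing w (h *: v + x)) (pairing w v).
  have -> : (fun h => pairing w (h *: v + x)) =
            (fun h : R => h * pairing w v + pairing w x).
    by apply/funext => h; rewrite pairingDr pairingZr.
  by apply: is_derive_eq; rewrite scaler0 add0r addr0 [_ *: _]mulr1.
have at0 (w : 'cV[R]_n) : pairing w (0 *: v + x) = pairing w x.
  by rewrite scale0r add0r.
have da : is_derive (0 : R) 1 (fun h => (pairing a (h *: v + x))^-1)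
    (- (pairing a x) ^- 2 *: pairing a v).
  by rewrite -(at0 a); apply: is_deriveV; rewrite ?at0.
have dba := is_deriveM (affine b) da.
apply: (is_derive_eq (is_derive1_comp (is_derive1_atan _) dba)).
(* Scalings in [R] are restated as products, by conversion, so that [field] recognises them. *)
rewrite -[LHS]/((1 + (pairing b (0 *: v + x) / pairing a (0 *: v + x)) ^+ 2)^-1 *
  (pairing b (0 *: v + x) * (- (pairing a x) ^- 2 * pairing a v) +
   (pairing a (0 *: v + x))^-1 * pairing b v)) !at0 /angular_derive.
field.
by rewrite ax0 sum_sqr_neq0.
Qed.

Lemma continuous_angular_derive {R : realType} {n : nat} (a b v x : 'cV[R]_n) :
  pairing a x != 0 -> {for x, continuous (fun y => angular_derive a b y v)}.
Proof.
move=> ax0; have cp w : pairing w y @[y --> x] --> pairing w x.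
  exact: continuous_pairing.
have cN : pairing a y * pairing b v - pairing b y * pairing a v @[y --> x] -->
    pairing a x * pairing b v - pairing b x * pairing a v.
  exact: (cvgB (cvgM (cp a) (cvg_cst _)) (cvgM (cp b) (cvg_cst _))).
have cD : pairing a y ^+ 2 + pairing b y ^+ 2 @[y --> x] -->
    pairing a x ^+ 2 + pairing b x ^+ 2.
  exact: (cvgD (cvgM (cp a) (cp a)) (cvgM (cp b) (cp b))).
exact: (cvgM cN (cvgV (sum_sqr_neq0 _ ax0) cD)).
Qed.

(** The numerator is linear in the direction and the denominator does not involve it, so partial
    derivatives weighted by the coordinates of [y] add up to the derivative along [y]. *)
Lemma angular_derive_sum {R : realType} {n : nat} (a b x y : 'cV[R]_n) :
  \sum_(i < n) y i 0 * angular_derive a b x (delta_mx i 0) =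
  angular_derive a b x y.
Proof.
rewrite /angular_derive [pairing b y]/pairing [pairing a y]/pairing.
rewrite !mulr_sumr -sumrB mulr_suml.
by apply: eq_bigr => i _; rewrite !pairing_delta; ring.
Qed.

(** Put [p], [q] for the pairings of [x] with the real and imaginary parts of [nu], and
    [lambda = r + s i]. Along [A *m x] they change at rates [r p - s q] and [r q + s p], and [p (r q
    + s p) - q (r p - s q) = s (p^2 + q^2)]. *)
Lemma angular_derive_eigenvector {R : realType} {n : nat} {A : 'M[R]_n}
    {lambda : R[i]} {nu : 'cV[R[i]]_n} {x : 'cV[R]_n} :
  eigenvector A^T lambda nu -> pairing (Re_vec nu) x != 0 ->
  angular_derive (Re_vec nu) (Im_vec nu) x (A *m x) = complex.Im lambda.
Proof.
move=> /eigenvector_Re_Im[+ ImE] nux0; rewrite -scaleNr => ReE.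
rewrite /angular_derive !pairing_mulmx ReE ImE !pairingDl !pairingZl.
apply: (canLR (mulfK (sum_sqr_neq0 _ nux0))).
ring.
Qed.

Theorem theorem1p4 (R : realType) (n : nat) (A : 'M[R]_n)
    (nu1 nu2 : 'cV[R[i]]_n) (lambda1 lambda2 : R[i])
    (hnu1 : eigenvector A^T lambda1 nu1)
    (hnu2 : eigenvector A^T lambda2 nu2)
    (hfree : free [:: nu1; nu2])
    (hlambda1 : complex.Im lambda1 != 0)
    (hlambda2 : complex.Im lambda2 != 0)
    (hconj : lambda1 != conjc lambda2)
    (X : set 'cV[R]_n) (hX : domain X)
    (hsub : X `<=` [set x | pairing (Re_vec nu1) x != 0 /\
                            pairing (Re_vec nu2) x != 0]) :
  autonomous_first_integral A X (fun x =>
    complex.Im lambda1 *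
      atan (pairing (Im_vec nu2) x / pairing (Re_vec nu2) x) -
    complex.Im lambda2 *
      atan (pairing (Im_vec nu1) x / pairing (Re_vec nu1) x)).
Proof.
set F := (F in autonomous_first_integral _ _ F).
pose dF x v :=
  complex.Im lambda1 * angular_derive (Re_vec nu2) (Im_vec nu2) x v -
  complex.Im lambda2 * angular_derive (Re_vec nu1) (Im_vec nu1) x v.
have FdF x v : X x -> is_derive x v F (dF x v).
  move=> /hsub[nu1x nu2x].
  by apply: is_deriveB; apply: is_deriveZ; exact: is_derive_atan_pairing.
have partialF i x : X x -> partial F i x = dF x (delta_mx i 0).
  by move=> Xx; have [] := FdF x (delta_mx i 0) Xx.
split=> [i|x Xx].
  split=> [x Xx|]; first by have [] := FdF x (delta_mx i 0) Xx.
  (* The formula for the partial derivative is known only on [X], so continuity within [X] is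
     transferred from [dF], which is continuous at every point of [X]. *)
  apply: (@subspace_eq_continuous _ X _ (fun x => dF x (delta_mx i 0))).
    by move=> x /[!inE] Xx; exact: esym (partialF i x Xx).
  apply: continuous_in_subspaceT => x /[!inE] /hsub[nu1x nu2x].
  exact: (cvgB (cvgM (cvg_cst _) (continuous_angular_derive _ _ _ _ nu2x))
               (cvgM (cvg_cst _) (continuous_angular_derive _ _ _ _ nu1x))).
have [nu1x nu2x] := hsub _ Xx.
(* The constant weights are pulled out so that each sum becomes an angular rate along [A *m x]; both
   terms then equal the product of the two imaginary parts. *)
under eq_bigr do rewrite partialF// mulrBr ![_ * (complex.Im _ * _)]mulrCA.
rewrite sumrB -!mulr_sumr !angular_derive_sum.
rewrite (angular_derive_eigenvector hnu1 nu1x).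
by rewrite (angular_derive_eigenvector hnu2 nu2x) mulrC subrr.
Qed.
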